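(* Let $\alpha\in(0,1)$ and $\lambda>0$ be real numbers and let $n$ be an integer with $n\ge \frac{1}{\alpha}+1$. Then $$\sup_{(x_1,\dots,x_n)\in H_\lambda} F_\alpha(x_1,\dots,x_n) = \max\left(n-1, \frac{n}{(1+\lambda)^\alpha}\right).$$
   Context: For a positive integer $n$, a real number $\alpha$ and a real number $\lambda>0$, define $$F_\alpha(x_1,x_2,\dots,x_n)=\sum_{i=1}^{n}\frac{1}{(1+x_i)^\alpha}$$ and $$H_\lambda=\{(x_1,x_2,\dots,x_n)\in\mathbb{R}^n : x_1x_2\cdots x_n=\lambda^n,\ x_1,x_2,\dots,x_n>0\}.$$ *)

(* Defs.v *)
From HB Require Import structures.
From mathcomp Require Import all_boot all_order all_algebra.
From mathcomp Require Import all_classical all_reals all_analysis.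

Set Implicit Arguments.
Unset Strict Implicit.
Unset Printing Implicit Defensive.

Import Order.TTheory GRing.Theory Num.Theory.

Local Open Scope classical_set_scope.
Local Open Scope ring_scope.

Definition F (R : realType) (n : nat) (alpha : R) (x : 'rV[R]_n) : R :=
  \sum_(i < n) 1 / (1 + x ord0 i) `^ alpha.

Definition H (R : realType) (n : nat) (lambda : R) : set 'rV[R]_n :=
  [set x | \prod_(i < n) x ord0 i = lambda ^+ n /\ forall i, 0 < x ord0 i].
Arguments H {R} n lambda.

(* Main.v *)
(* Put p = 1/alpha, m = n - 1 and u_i = (1 + x_i)^(-alpha), so that
   ln x_i = psi(u_i) with psi(u) = ln(u^(-p) - 1), and
   psi'(u) = - p / q(u) with q(u) = u (1 - u^p). The claim becomes: if
   sum u_i >= m, then the sum of the psi(u_i) is at most n psi(mean of the u_i).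
   The key fact is that q(u) <= q(v) whenever v <= u and p (1 - u) <= v. Let v be
   the least u_i and b the mean of the others; then m (1 - b) <= v. The key fact
   puts psi below its tangent at b on [v, 1[, so the other u_i may all be
   replaced by b; it also makes m psi(b) + psi(v) increase when b and v are
   moved towards each other with m b + v fixed. *)
Require Import Defs.
From HB Require Import structures.
From mathcomp Require Import all_boot all_order all_algebra.
From mathcomp Require Import all_classical all_reals all_analysis.
From mathcomp Require Import ring lra.

Set Implicit Arguments.
Unset Strict Implicit.
Unset Printing Implicit Defensive.

Import Order.TTheory GRing.Theory Num.Theory.
Import numFieldNormedType.Exports.

Local Open Scope classical_set_scope.
Local Open Scope ring_scope.

(** * The key inequality for [q(u) = u (1 - u^p)] *)

Lemma is_derive_ge0_le (R : realType) (f df : R -> R) (a b : R) : a <= b ->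
  (forall x, a <= x <= b -> is_derive x 1 f (df x)) ->
  (forall x, a <= x <= b -> 0 <= df x) -> f a <= f b.
Proof.
move=> ab fdf df0.
have cf : {within `[a, b], continuous f}.
  apply: derivable_within_continuous => x; rewrite in_itv /= => xab.
  exact: (@ex_derive _ _ _ _ _ _ _ (fdf x xab)).
have fdf' x : x \in `]a, b[ -> is_derive x 1 f (df x).
  by rewrite in_itv /= => /andP[ax xb]; apply: fdf; rewrite !ltW.
have [c] := MVT_segment ab fdf' cf.
rewrite in_itv /= => cab fE.
by rewrite -subr_ge0 fE mulr_ge0 ?df0// subr_ge0.
Qed.

(** Right side minus left side vanishes at [u = v] and is nondecreasing in [u]. With
    [t = v / (p x)], its derivative at [x] is [(p + 1) x^p] times
    [1 - (1 + t)^(p - 1) (1 - (p - 1) t)], and the subtracted product is at most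
    [e^((p - 1) t) e^(-(p - 1) t) = 1]. The shift [v / p] is the one that turns [p (1 - u) <= v]
    into [1 <= u + v / p]. *)
Lemma powR_slope_ge (R : realType) (p v u : R) : 1 <= p -> 0 < v -> v <= u ->
  (u - v) * (u + v / p) `^ p <= u * u `^ p - v * v `^ p.
Proof.
move=> p1 v0 vu.
have p0 : 0 < p by lra.
have vp0 : 0 < v / p by rewrite divr_gt0.
pose f x : R := x * x `^ p - (x - v) * (x + v / p) `^ p.
pose df x : R := (x * (p * x `^ (p - 1)) + x `^ p) -
  ((x - v) * (p * (x + v / p) `^ (p - 1)) + (x + v / p) `^ p).
suff : f v <= f u by rewrite /f; lra.
apply: (@is_derive_ge0_le _ f df) => // x /andP[vx _].
  have x0 : 0 < x by lra.
  have xv0 : 0 < x + v / p by lra.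
  have dxv : is_derive x 1 (fun x : R => x + v / p) 1.
    by apply: (is_derive_eq (is_deriveD (is_derive_id x 1)
      (is_derive_cst (v / p) x 1))); rewrite addr0.
  have dxB : is_derive x 1 (fun x : R => x - v) 1.
    by apply: (is_derive_eq (is_deriveB (is_derive_id x 1)
      (is_derive_cst v x 1))); rewrite subr0.
  have dc := @is_derive1_comp _ (fun y : R => y `^ p)
    (fun x : R => x + v / p) x _ _ (is_derive1_powR p xv0) dxv.
  apply: (is_derive_eq (is_deriveB
    (is_deriveM (is_derive_id x 1) (is_derive1_powR p x0)) (is_deriveM dxB dc))).
  by rewrite /df /GRing.scale /=; ring.
rewrite /df.
have x0 : 0 < x by lra.
have xv0 : 0 < x + v / p by lra.
rewrite -(mulr_powRB1 (ltW x0) p0) -(mulr_powRB1 (ltW xv0) p0).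
suff : (x + v / p) `^ (p - 1) * (x - (p - 1) * (v / p)) <= x `^ (p - 1) * x.
  move=> h; rewrite [leRHS](_ : _ = (p + 1) * (x `^ (p - 1) * x -
    (x + v / p) `^ (p - 1) * (x - (p - 1) * (v / p)))); last by field; lra.
  by rewrite mulr_ge0 ?subr_ge0//; lra.
pose t := v / p / x.
have t0 : 0 < t by rewrite divr_gt0.
have -> : x + v / p = x * (1 + t) by rewrite /t; field; lra.
have -> : x - (p - 1) * (v / p) = x * (1 - (p - 1) * t) by rewrite /t; field; lra.
rewrite powRM; [|lra|lra].
rewrite -mulrA ler_pM2l ?powR_gt0//.
rewrite mulrCA -[leRHS]mulr1 ler_pM2l//.
(* The factor [1 - (p - 1) t] is nonnegative because [v <= x], so [1 + t] may be replaced by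
   [e^t]. *)
apply: (@le_trans _ _ (expR ((p - 1) * t) * (1 - (p - 1) * t))).
  rewrite ler_wpM2r//.
    have -> : 1 - (p - 1) * t = ((x - v) + v / p) / x by rewrite /t; field; lra.
    by rewrite divr_ge0//; lra.
  rewrite mulrC expRM ge0_ler_powR ?nnegrE ?expR_ge0 ?expR_ge1Dx//; lra.
rewrite -[leRHS](expR0) -(subrr ((p - 1) * t)) expRD.
rewrite ler_pM2l ?expR_gt0//.
exact: expR_ge1Dx.
Qed.

(** The claim rearranges to [u - v <= u^(p + 1) - v^(p + 1)]. In [powR_slope_ge] the factor
    [(u + v / p)^p] is at least 1 by the last hypothesis. *)
Lemma subr_mulr_powR_le (R : realType) (p v u : R) : 1 <= p -> 0 < v -> v <= u ->
  p * (1 - u) <= v -> u * (1 - u `^ p) <= v * (1 - v `^ p).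
Proof.
move=> p1 v0 vu puv.
have p0 : 0 < p by lra.
have uv1 : 1 <= u + v / p by rewrite -lerBlDl ler_pdivlMr// mulrC.
have : u - v <= (u - v) * (u + v / p) `^ p.
  by rewrite ler_peMr ?subr_ge0// (le_trans uv1)// le1r_powR.
have := powR_slope_ge p1 v0 vu.
by rewrite !mulrBr !mulr1; lra.
Qed.

(** * The function [psi]: derivative, tangent bound, two-point inequality *)

Lemma powR_lt1 (R : realType) (p u : R) : 0 < p -> 0 <= u -> u < 1 -> u `^ p < 1.
Proof.
move=> p0 u0 u1; have := @gt0_ltr_powR _ p p0 u 1.
by rewrite powR1; apply; rewrite // nnegrE.
Qed.

(* [psi p u = ln x] for [u = (1 + x) `^ (- p^-1)], i.e. [x = u `^ (- p) - 1]. *)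
Definition psi (R : realType) (p u : R) : R := ln (1 - u `^ p) - p * ln u.

Lemma is_derive_psi (R : realType) (p u : R) : 0 < p -> 0 < u -> u < 1 ->
  is_derive u 1 (psi p) (- (p / (u * (1 - u `^ p)))).
Proof.
move=> p0 u0 u1.
have up1 : u `^ p < 1 by rewrite powR_lt1// ltW.
have up1' : 0 < 1 - u `^ p by rewrite subr_gt0.
have dc : is_derive u 1 (fun u : R => 1 - u `^ p) (- (p * u `^ (p - 1))).
  apply: (is_derive_eq (is_deriveB (is_derive_cst (1 : R) u 1)
    (is_derive1_powR p u0))).
  by rewrite sub0r.
have dl := @is_derive1_comp _ (@ln R) (fun u : R => 1 - u `^ p) u _ _
  (is_derive1_ln up1') dc.
apply: (is_derive_eq (is_deriveB dl (is_deriveZ p (is_derive1_ln u0)))).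
rewrite /GRing.scale /= -(mulr_powRB1 (ltW u0) p0).
move: up1'; rewrite -(mulr_powRB1 (ltW u0) p0) => /lt0r_neq0 h.
by field; rewrite h gt_eqF.
Qed.

(** Slopes are compared only with the slope at [w]: the key inequality gives [q(x) >= q(w)] for
    [v <= x <= w] and [q(x) <= q(w)] for [w <= x < 1]. Hence [psi] minus its tangent increases up to
    [w], where it is 0, and decreases afterwards. *)
Lemma psi_le_tangent (R : realType) (p v w u : R) : 1 <= p -> 0 < v -> v <= w ->
  w < 1 -> p * (1 - w) <= v -> v <= u -> u < 1 ->
  psi p u <= psi p w - p / (w * (1 - w `^ p)) * (u - w).
Proof.
move=> p1 v0 vw w1 pwv vu u1.
have p0 : 0 < p by lra.
set c := p / _.
have q0 (x : R) : 0 < x -> x < 1 -> 0 < x * (1 - x `^ p).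
  by move=> x0 x1; rewrite mulr_gt0// subr_gt0 powR_lt1// ltW.
have dB (b : R) : is_derive b 1 (fun x : R => c * x) c.
  apply: (is_derive_eq (is_deriveZ c (is_derive_id b 1))).
  by rewrite /GRing.scale /= mulr1.
case: (leP u w) => [uw|/ltW wu].
  suff : psi p u + c * u <= psi p w + c * w by rewrite mulrBr; lra.
  apply: (@is_derive_ge0_le _ (fun x => psi p x + c * x)
      (fun x => - (p / (x * (1 - x `^ p))) + c)) => // x /andP[ux xw].
    by apply: is_deriveD; apply: is_derive_psi; lra.
  have : p / (x * (1 - x `^ p)) <= c.
    rewrite ler_pM2l// lef_pV2 ?posrE ?q0; try lra.
    by rewrite subr_mulr_powR_le//; lra.
  lra.
suff : - psi p w - c * w <= - psi p u - c * u by rewrite mulrBr; lra.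
apply: (@is_derive_ge0_le _ (fun x => - psi p x - c * x)
    (fun x => - - (p / (x * (1 - x `^ p))) - c)) => // x /andP[wx xu].
  by apply: is_deriveB; apply: is_deriveN; apply: is_derive_psi; lra.
have : c <= p / (x * (1 - x `^ p)).
  rewrite ler_pM2l// lef_pV2 ?posrE ?q0; try lra.
  rewrite subr_mulr_powR_le//; try lra.
  have : p * (1 - x) <= p * (1 - w) by rewrite ler_pM2l//; lra.
  lra.
lra.
Qed.

(* The derivative of the right-hand side in [v] along [m * u + v = (m + 1) * w]
   is nonnegative, as [p * (1 - u) <= m * (1 - u) <= v]. *)
Lemma psi_two_point (R : realType) (p m v u w : R) : 1 <= p -> p <= m -> 0 < v ->
  v <= u -> u < 1 -> m * (1 - u) <= v -> m * u + v = (m + 1) * w ->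
  m * psi p u + psi p v <= (m + 1) * psi p w.
Proof.
move=> p1 pm v0 vu u1 muv uvw.
have m0 : 0 < m by lra.
(* The pair [(g s, s)] runs along the line [m x + y = (m + 1) w], from [(u, v)] at [s = v] to
   [(w, w)] at [s = w]. *)
pose g s : R := ((m + 1) * w - s) / m.
have gE s : m * g s = (m + 1) * w - s by rewrite /g mulrC divfK// gt_eqF.
have gv : g v = u by apply: (mulfI (lt0r_neq0 m0)); rewrite gE; lra.
have gw : g w = w by apply: (mulfI (lt0r_neq0 m0)); rewrite gE; lra.
have vw : v <= w.
  have m1 : 0 < m + 1 by lra.
  by rewrite -(ler_pM2l m1) -uvw; have := ler_wpM2l (ltW m0) vu; lra.
have dg (s : R) : is_derive s 1 g (- m^-1).
  have -> : g = (fun s => m^-1 * ((m + 1) * w) - m^-1 * s).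
    by apply/funext => t; rewrite /g; field; rewrite gt_eqF.
  apply: (is_derive_eq (is_deriveB (is_derive_cst (m^-1 * ((m + 1) * w)) s 1)
    (is_deriveZ m^-1 (is_derive_id s 1)))).
  by rewrite /GRing.scale /= mulr1 sub0r.
have -> : (m + 1) * psi p w = m * psi p (g w) + psi p w by rewrite gw; ring.
rewrite -gv.
have gP s : v <= s <= w -> s <= g s /\ g s < 1.
  move=> /andP[vs sw]; split.
    rewrite -(ler_pM2l m0) gE.
    have := ler_wpM2l (ltW m0) sw; lra.
  rewrite -(ltr_pM2l m0) gE mulr1.
  have := ltr_pM2l m0 u 1; rewrite u1 mulr1; lra.
have q0 (x : R) : 0 < x -> x < 1 -> 0 < x * (1 - x `^ p).
  by move=> x0 x1; rewrite mulr_gt0// subr_gt0 powR_lt1//; lra.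
apply: (@is_derive_ge0_le _ (fun s => m * psi p (g s) + psi p s)
  (fun s => p / (g s * (1 - g s `^ p)) - p / (s * (1 - s `^ p)))) => // s svw.
  have [sg g1] := gP _ svw; case/andP: svw => vs sw.
  have d1 : is_derive (g s) 1 (psi p) (- (p / (g s * (1 - g s `^ p)))).
    by apply: is_derive_psi; lra.
  have d2 := @is_derive1_comp _ _ _ _ _ _ d1 (dg s).
  have d3 : is_derive s 1 (psi p) (- (p / (s * (1 - s `^ p)))).
    by apply: is_derive_psi; lra.
  apply: (is_derive_eq (is_deriveD (is_deriveZ m d2) d3)).
  by rewrite /GRing.scale /= mulrNN [_ / m]mulrC mulrA divff ?mul1r// gt_eqF.
have [sg g1] := gP _ svw; case/andP: svw => vs sw.
rewrite subr_ge0 ler_pM2l ?lef_pV2 ?posrE ?q0; try lra.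
rewrite subr_mulr_powR_le//; try lra.
(* [m (1 - g s) - s] is constant along the line and equals [m (1 - u) - v <= 0]. *)
have : p * (1 - g s) <= m * (1 - g s) by rewrite ler_wpM2r//; lra.
have := gE s; have : m * u = (m + 1) * w - v by lra.
move: muv; rewrite !mulrBr !mulr1; lra.
Qed.

(** * From two values to [m + 1] values *)

Lemma sum_psi_le_mean (R : realType) (p : R) (m : nat) (u : 'I_m.+1 -> R) :
  1 <= p -> p <= m%:R -> (forall i, 0 < u i < 1) -> m%:R <= \sum_i u i ->
  \sum_i psi p (u i) <= m.+1%:R * psi p ((\sum_i u i) / m.+1%:R).
Proof.
move=> p1 pm u01 mu.
have mgt0 : 0 < m%:R :> R by lra.
have Sm : m.+1%:R = m%:R + 1 :> R by rewrite -natr1.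
pose j := [arg min_(i < ord0) u i]%O.
have uj i : u j <= u i by rewrite /j; case: arg_minP => // k _; apply.
have sumc (c : R) : \sum_(i < m.+1 | i != j) c = m%:R * c.
  by rewrite sumr_const cardC1 card_ord mulr_natl.
have cardj : \sum_(i < m.+1 | i != j) (1 : R) = m%:R by rewrite sumc mulr1.
have sumE (f : 'I_m.+1 -> R) : \sum_i f i = f j + \sum_(i | i != j) f i.
  by rewrite (bigD1 j).
set S := \sum_(i | i != j) u i.
have uS : \sum_i u i = u j + S by exact: sumE.
pose b := S / m%:R.
have mb : m%:R * b = S by rewrite /b mulrC divfK// gt_eqF.
have jS : m%:R * u j <= S.
  by rewrite -sumc ler_sum.
have S1 : S < m%:R.
  rewrite -cardj; apply: ltr_sum => [|i _]; last by case/andP: (u01 i).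
  (* Strictness needs an index other than [j]; one exists since [m > 0]. *)
  have : (0 < #|[pred i | i != j]|)%N by rewrite cardC1 card_ord -(ltr_nat R).
  case/card_gt0P => i; rewrite inE => ij.
  by apply/hasP; exists i; rewrite ?mem_index_enum.
have jb : u j <= b by rewrite -(ler_pM2l mgt0) mb.
have b1 : b < 1 by rewrite -(ltr_pM2l mgt0) mb mulr1.
have [j0 j1] := andP (u01 j).
(* This is the hypothesis that the sum, [u j + m b], is at least [m]. *)
have mbj : m%:R * (1 - b) <= u j by rewrite mulrBr mulr1 mb; lra.
have pbj : p * (1 - b) <= u j.
  by apply: le_trans mbj; rewrite ler_wpM2r//; lra.
have sum_b : \sum_(i | i != j) (u i - b) = 0 by rewrite sumrB sumc mb subrr.
have sum_le : \sum_(i | i != j) psi p (u i) <= m%:R * psi p b.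
  set c := p / (b * (1 - b `^ p)).
  (* The linear terms of the tangent at [b] cancel in the sum, [b] being the mean of the [u i] with
     [i != j]. *)
  have -> : m%:R * psi p b = \sum_(i | i != j) (psi p b - c * (u i - b)).
    by rewrite sumrB -mulr_sumr sum_b mulr0 subr0 sumc.
  apply: ler_sum => i _; apply: (@psi_le_tangent _ p (u j)) => //.
  by case/andP: (u01 i).
apply: (@le_trans _ _ (m%:R * psi p b + psi p (u j))).
  by rewrite sumE addrC lerD2r.
rewrite Sm; apply: psi_two_point => //.
by rewrite mb uS addrC mulrC divfK//; lra.
Qed.

(** * Back to the variables [x_i]: the upper bound *)

Lemma psi_one_add_powR (R : realType) (a x : R) : 0 < a -> 0 < x ->
  psi a^-1 (1 / (1 + x) `^ a) = ln x.
Proof.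
move=> a0 x0; have x1 : 0 < 1 + x by lra.
rewrite div1r -powRN /psi -powRrM mulNr divff ?gt_eqF// powR_inv1 ?ltW//.
rewrite ln_powR mulNr mulrN mulrA mulVf ?gt_eqF// mul1r opprK.
have -> : 1 - (1 + x)^-1 = x / (1 + x) by field; rewrite gt_eqF.
by rewrite ln_div ?posrE// subrK.
Qed.

(** Both [ln (1 - u^p)] and [- p ln u] are strictly decreasing on []0, 1[]. *)
Lemma psi_le_inv (R : realType) (p u v : R) : 0 < p -> 0 < u -> u < 1 ->
  0 < v -> v < 1 -> psi p u <= psi p v -> v <= u.
Proof.
move=> p0 u0 u1 v0 v1; apply: contraTT; rewrite -!ltNge => uv.
have uvp : u `^ p < v `^ p by apply: gt0_ltr_powR; rewrite ?nnegrE ?ltW.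
have vp : v `^ p < 1 by rewrite powR_lt1// ltW.
rewrite /psi ltrB//.
  by rewrite ltr_ln ?posrE ?subr_gt0 ?ltrD2l ?ltrN2// (lt_trans uvp).
by rewrite ltr_pM2l// ltr_ln.
Qed.

Lemma one_div_powR_itv (R : realType) (a x : R) : 0 < a -> 0 < x ->
  0 < 1 / (1 + x) `^ a < 1.
Proof.
move=> a0 x0; have h : 1 < (1 + x) `^ a.
  have := @gt0_ltr_powR _ a a0 1 (1 + x).
  by rewrite powR1; apply; rewrite ?nnegrE//; lra.
by rewrite div1r invr_gt0 invf_lt1; [rewrite h (lt_trans ltr01 h)|lra].
Qed.

(** The values of [psi] sum to the logarithm of the product of the [x_i], that is [n ln lambda] with
    [n = m + 1]. So [sum_psi_le_mean] compares [psi] at [(1 + lambda)^(-alpha)] with [psi] at the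
    mean [F / n], and [psi] can be inverted. *)
Lemma F_le (R : realType) (alpha lambda : R) (m : nat) (x : 'rV[R]_m.+1) :
  0 < alpha -> alpha < 1 -> 0 < lambda -> alpha^-1 <= m%:R ->
  H m.+1 lambda x -> m%:R <= F alpha x ->
  F alpha x <= m.+1%:R / (1 + lambda) `^ alpha.
Proof.
move=> a0 a1 l0 am [xl x0] mF.
have p1 : 1 <= alpha^-1 by rewrite invf_ge1// ltW.
have u01 i : 0 < 1 / (1 + x ord0 i) `^ alpha < 1 by exact: one_div_powR_itv.
have := sum_psi_le_mean p1 am u01 mF; rewrite -/(F alpha x).
have -> : \sum_i psi alpha^-1 (1 / (1 + x ord0 i) `^ alpha) =
    m.+1%:R * ln lambda.
  under eq_bigr do rewrite psi_one_add_powR//.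
  rewrite mulr_natl -lnXn// -xl -[LHS]expRK expR_sum.
  by congr ln; apply: eq_bigr => i _; rewrite lnK// posrE.
rewrite ler_pM2l ?ltr0n// -(psi_one_add_powR a0 l0) => h.
have n0 : 0 < m.+1%:R :> R by rewrite ltr0n.
have [l1 l2] := andP (one_div_powR_itv a0 l0).
rewrite mulrC -ler_pdivrMr// -[leRHS]div1r; apply: psi_le_inv h; rewrite ?invr_gt0//.
  by rewrite divr_gt0// (lt_le_trans _ mF)//; lra.
rewrite ltr_pdivrMr// mul1r /F.
have -> : m.+1%:R = \sum_(i < m.+1) (1 : R) by rewrite sumr_const card_ord.
apply: ltr_sum => [|i _]; last by case/andP: (u01 i).
by apply/hasP; exists ord0; rewrite ?mem_index_enum.
Qed.

(** * Lower bounds from explicit points of [H], and the supremum *)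

Lemma H_const (R : realType) (lambda : R) (n : nat) : 0 < lambda ->
  H n lambda (const_mx lambda).
Proof.
move=> l0; split=> [|i]; last by rewrite mxE.
by under eq_bigr do rewrite mxE; rewrite prodr_const card_ord.
Qed.

Lemma F_const (R : realType) (alpha lambda : R) (n : nat) :
  F alpha (const_mx lambda : 'rV_n) = n%:R / (1 + lambda) `^ alpha.
Proof.
rewrite /F; under eq_bigr do rewrite mxE.
by rewrite sumr_const card_ord -[LHS]mulr_natl div1r.
Qed.

(** All coordinates but the last equal [y], and the last restores the product. As
    [(1 + y)^alpha <= 1 + y], the bound is free of powers, so that a suitable [y] can be given by a
    rational formula. *)
Lemma H_F_ge (R : realType) (alpha lambda y : R) (m : nat) : 0 <= alpha ->
  alpha <= 1 -> 0 < lambda -> 0 < y ->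
  exists2 x, H m.+1 lambda x & m%:R / (1 + y) <= F alpha x.
Proof.
move=> a0 a1 l0 y0.
exists (\row_i if i == ord_max then lambda ^+ m.+1 / y ^+ m else y).
  split=> [|i]; last by rewrite mxE; case: ifP => // _; rewrite divr_gt0 ?exprn_gt0.
  rewrite big_ord_recr /= !mxE eqxx.
  rewrite (eq_bigr (fun=> y)) => [|i _]; last first.
    by rewrite mxE -val_eqE /= ltn_eqF.
  by rewrite prodr_const card_ord mulrC divfK// expf_neq0// gt_eqF.
rewrite /F big_ord_recr /= (eq_bigr (fun=> 1 / (1 + y) `^ alpha)); last first.
  by move=> i _; rewrite mxE -val_eqE /= ltn_eqF.
rewrite sumr_const card_ord -[X in _ <= X + _]mulr_natl [1 / _ `^ _]div1r.
rewrite -[leLHS]addr0 lerD//.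
  rewrite ler_wpM2l// lef_pV2 ?posrE ?powR_gt0; try lra.
  by rewrite ler1_powR//; lra.
by rewrite divr_ge0// powR_ge0.
Qed.

(* The right-hand side is positive, so the equation also says that the set of
   values has a supremum: [sup] is 0 on sets that have none. *)
Theorem proposition5 (R : realType) (alpha lambda : R) (n : nat)
  (alpha_gt0 : 0 < alpha) (alpha_lt1 : alpha < 1) (lambda_gt0 : 0 < lambda)
  (n_ge : 1 / alpha + 1 <= n%:R) :
  sup [set F alpha x | x in H n lambda] =
  Num.max (n%:R - 1) (n%:R / (1 + lambda) `^ alpha).
Proof.
case: n n_ge => [|m] n_ge.
  have a0 : 0 < 1 / alpha by rewrite divr_gt0.
  by move: n_ge; rewrite leNgt addr_gt0.
have am : alpha^-1 <= m%:R by move: n_ge; rewrite -natr1 div1r; lra.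
have -> : m.+1%:R - 1 = m%:R :> R by rewrite -natr1 addrK.
set E := [set F alpha x | x in _].
set M := Num.max _ _.
have ubE : ubound E M.
  move=> _ [x xH <-]; rewrite le_max.
  by have [//|/ltW mF] := leP (F alpha x) m%:R; exact: F_le.
have bE : has_ubound E by exists M.
have cE : E (m.+1%:R / (1 + lambda) `^ alpha).
  by exists (const_mx lambda); [exact: H_const|exact: F_const].
have E0 : E !=set0 by eexists; exact: cE.
apply/eqP; rewrite eq_le ge_sup//= ge_max [X in _ && X](ub_le_sup bE)// andbT.
have sup0 : 0 < sup E.
  apply: lt_le_trans (ub_le_sup bE cE).
  by rewrite divr_gt0 ?ltr0n// powR_gt0; lra.
rewrite leNgt; apply/negP => supm.
(* With this [y], [sup E * (1 + y)] is the midpoint of [sup E] and [m], hence less than [m], while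
   [H_F_ge] makes it at least [m]. *)
pose y := (m%:R - sup E) / (2 * sup E).
have y0 : 0 < y by rewrite divr_gt0//; lra.
have [x xH mF] := H_F_ge m (ltW alpha_gt0) (ltW alpha_lt1) lambda_gt0 y0.
have : m%:R / (1 + y) <= sup E.
  by apply: le_trans mF (ub_le_sup bE _); exists x.
rewrite ler_pdivrMr; last by lra.
have -> : sup E * (1 + y) = sup E + (m%:R - sup E) / 2.
  by rewrite /y; field; rewrite gt_eqF.
lra.
Qed.
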